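(* Let $(G,\cdot)$ be a quasigroup satisfying the identity $((xy)z)y = x\bigl(y(zy)\bigr)$ for all $x,y,z\in G$, and let $j:G\to G$ be the map $j(x):=x\backslash x$. Then $j$ is idempotent in $\mathbf{Set}$: $j\circ j=j$.
   Context: A quasigroup is a set $G$ with a binary operation $\cdot:G\times G\to G$ (also written by juxtaposition) such that for all $a,b\in G$ the equations $a\cdot x=b$ and $y\cdot a=b$ have unique solutions $x$, $y$ in $G$. The left division $a\backslash b$ denotes the unique $x$ with $a\cdot x=b$; thus $j(x)=x\backslash x$ is the unique element with $x\cdot j(x)=x$. The word ''endomorphism'' in this setting means just a self-map of the set $G$; $j$ is not assumed to be a homomorphism. *)

(* Defs.v *)
From Stdlib Require Import ClassicalEpsilon.

Record quasigroup : Type := Quasigroup {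
  carrier :> Type;
  mul : carrier -> carrier -> carrier;
  mul_left_solvable : forall a b : carrier, exists! x : carrier, mul a x = b;
  mul_right_solvable : forall a b : carrier, exists! y : carrier, mul y a = b
}.

Arguments mul {q} _ _.
Arguments mul_left_solvable {q} _ _.
Arguments mul_right_solvable {q} _ _.

Declare Scope quasigroup_scope.
Delimit Scope quasigroup_scope with qg.
Notation "x * y" := (mul x y) : quasigroup_scope.

Definition ldiv {G : quasigroup} (a b : G) : G :=
  proj1_sig (constructive_definite_description _ (mul_left_solvable a b)).

Notation "a \ b" := (ldiv a b)
  (at level 40, left associativity) : quasigroup_scope.

Lemma mul_ldiv (G : quasigroup) (a b : G) : (a * (a \ b) = b)%qg.
Proof.
  exact (proj2_sig (constructive_definite_description _ (mul_left_solvable a b))).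
Qed.

Definition j {G : quasigroup} (x : G) : G := (x \ x)%qg.

(* Main.v *)
Require Import Defs.
From Stdlib Require Import Basics FunctionalExtensionality.

(** Write [j] for the local right unit of an element [y], so [y * j = y], and
    put [f = j * j].  Reading the identity as [R_y R_z R_y = R_(y(zy))] for
    the right translations shows that right translations have inverses of the
    same kind.  Cancellation then gives [R_j R_j = 1], next that [f] is
    idempotent, and that [{f, j}] multiplies like a group of order at most two
    with unit [f].  The claim is [j = f].

    The product [x ** z = (x f) * (f (f z))] is an isotope with unit [f].
    With [R x = x f], [L x = f x] and [T = L L], the identity forces
    [R R = 1], [L L L = 1] and [R L R = T]; moreover [R] is an automorphism
    of [**], which satisfies the right Bol law, and what is left of the
    identity is an equation linking [**] with [L] (construction [isotope]).
    In this picture [j] is an involution fixed by [R], [L] and [T], and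
    [R y = y ** j].

    The linking equation shows that both translations by [j] commute with [L]
    and [T] (lemmas [fixed_lmul_L] and [fixed_rmul_L]).  Hence, with
    [w = R y], one gets [L (w ** y) = w ** T y], and also the same equation
    with [L] and [T] exchanged, the axioms being symmetric in the two.  The
    linking equation also gives [w ** L y = L (T y ** T y)], so
    [T y ** T y = w ** T y] and [T y = w = y ** j].  Since [T] has order
    dividing three and [j] dividing two, this forces [y = y ** j], that is,
    [j = f]. *)

Local Open Scope quasigroup_scope.

(** * Cancellation *)

Lemma mul_cancel_l (G : quasigroup) (a x z : G) : a * x = a * z -> x = z.
Proof.
  intro E. destruct (mul_left_solvable a (a * z)) as [u [_ U]].
  rewrite <- (U x E). apply U. reflexivity.
Qed.

Lemma mul_cancel_r (G : quasigroup) (a x z : G) : x * a = z * a -> x = z.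
Proof.
  intro E. destruct (mul_right_solvable a (z * a)) as [u [_ U]].
  rewrite <- (U x E). apply U. reflexivity.
Qed.

(** * Loops twisted by three maps *)

(** The structure carried by the isotope at an idempotent.  The maps [R] and
    [L] generate a quotient of the symmetric group on three letters, and the
    axioms are invariant under exchanging [L] with its inverse [T]; this is
    why both of the linking equations [linkL] and [linkT] are recorded. *)
Record twisted_loop : Type := TwistedLoop {
  tcarrier :> Type;
  op : tcarrier -> tcarrier -> tcarrier;
  one : tcarrier;
  R : tcarrier -> tcarrier;
  L : tcarrier -> tcarrier;
  T : tcarrier -> tcarrier;
  op_one_l : forall x, op one x = x;
  op_one_r : forall x, op x one = x;
  op_cancel_l : forall a x z, op a x = op a z -> x = z;
  op_cancel_r : forall a x z, op x a = op z a -> x = z;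
  bol : forall x a c, op (op (op x a) c) a = op x (op (op a c) a);
  RR : forall x, R (R x) = x;
  LT : forall x, L (T x) = x;
  TL : forall x, T (L x) = x;
  LL : forall x, L (L x) = T x;
  TT : forall x, T (T x) = L x;
  RL : forall x, R (L x) = T (R x);
  RT : forall x, R (T x) = L (R x);
  L_one : L one = one;
  T_one : T one = one;
  linkL : forall a b, op (L (R a)) (L (op b a)) = T (op (op a (T b)) a);
  linkT : forall a b, op (T (R a)) (T (op b a)) = L (op (op a (L b)) a)
}.

Arguments op {t} _ _.
Arguments one {t}.
Arguments R {t} _.
Arguments L {t} _.
Arguments T {t} _.

Declare Scope twisted_scope.
Notation "x ** z" := (op x z) (at level 40, left associativity) : twisted_scope.
Local Open Scope twisted_scope.

Definition swap (Q : twisted_loop) : twisted_loop :=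
  TwistedLoop Q op one R T L (op_one_l Q) (op_one_r Q)
    (op_cancel_l Q) (op_cancel_r Q) (bol Q) (RR Q) (TL Q) (LT Q)
    (TT Q) (LL Q) (RT Q) (RL Q) (T_one Q) (L_one Q) (linkT Q) (linkL Q).

Record fixed_involution (Q : twisted_loop) (j : Q) : Prop := FixedInvolution {
  fix_R : R j = j;
  fix_L : L j = j;
  fix_T : T j = j;
  invol : j ** j = one
}.

Arguments fix_R {Q j} _.
Arguments fix_L {Q j} _.
Arguments fix_T {Q j} _.
Arguments invol {Q j} _.

Lemma fixed_involution_swap (Q : twisted_loop) (j : Q) :
  fixed_involution Q j -> fixed_involution (swap Q) j.
Proof. intros [HR HL HT H2]. constructor; assumption. Qed.

(** * Translations by a fixed involution *)

Lemma fixed_rmulK (Q : twisted_loop) (j : Q) (hj : fixed_involution Q j) (x : Q) :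
  (x ** j) ** j = x.
Proof.
  pose proof (bol Q x j one) as B.
  rewrite !op_one_r, (invol hj), op_one_r in B. exact B.
Qed.

Lemma fixed_lmul_conj (Q : twisted_loop) (j : Q) (hj : fixed_involution Q j)
    (x : Q) :
  j ** ((j ** x) ** j) = x ** j.
Proof.
  pose proof (bol Q j j x) as B. rewrite (invol hj), op_one_l in B.
  symmetry. exact B.
Qed.

Lemma fixed_conjK (Q : twisted_loop) (j : Q) (hj : fixed_involution Q j)
    (x : Q) :
  (j ** ((j ** x) ** j)) ** j = x.
Proof. rewrite fixed_lmul_conj, fixed_rmulK by exact hj. reflexivity. Qed.

(** For [D] and [C] the left and right translations by [j] and [P = C D], the
    linking equations read [D L C = T P T] and [D T C = L P L].  Their right
    sides are inverse to each other since [P P = 1], so [D T P L C = 1], whence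
    [D T P L = C = D P]. *)
Lemma fixed_conj_T (Q : twisted_loop) (j : Q) (hj : fixed_involution Q j)
    (x : Q) :
  T ((j ** x) ** j) = (j ** T x) ** j.
Proof.
  assert (H : forall c : Q, T ((j ** L c) ** j) = (j ** c) ** j).
  { intro c. apply (op_cancel_l Q j).
    rewrite fixed_lmul_conj by exact hj.
    pose proof (linkT Q j (j ** L c)) as B.
    rewrite (fix_R hj), (fix_T hj) in B. rewrite B.
    pose proof (linkL Q j (c ** j)) as A.
    rewrite (fix_R hj), (fix_L hj), fixed_rmulK in A by exact hj.
    rewrite A, LT, fixed_conjK, LT by exact hj. reflexivity. }
  rewrite <- (H (T x)), LT. reflexivity.
Qed.

Lemma fixed_conj_L (Q : twisted_loop) (j : Q) (hj : fixed_involution Q j)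
    (x : Q) :
  L ((j ** x) ** j) = (j ** L x) ** j.
Proof. exact (fixed_conj_T (swap Q) j (fixed_involution_swap Q j hj) x). Qed.

(** Once [P] commutes with [L] and [T], the linking equation becomes
    [D L C = P L], that is, [D = L (P C) T] because [C C = 1]. *)
Lemma fixed_lmul_twist (Q : twisted_loop) (j : Q) (hj : fixed_involution Q j)
    (x : Q) :
  j ** x = L ((j ** (T x ** j)) ** j).
Proof.
  pose proof (linkL Q j (T x ** j)) as A.
  rewrite (fix_R hj), (fix_L hj), fixed_rmulK, LT in A by exact hj.
  rewrite A, <- fixed_conj_T, TT by exact hj. reflexivity.
Qed.

(** By [fixed_lmul_twist] and its mirror image, [D = L X T = T X L] for
    [X = P C].  As [L] and [T] are squares of each other,
    [X = T T X L L = L X T = D]. *)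
Lemma fixed_lmul_split (Q : twisted_loop) (j : Q) (hj : fixed_involution Q j)
    (x : Q) :
  j ** x = (j ** (x ** j)) ** j.
Proof.
  pose proof (fixed_lmul_twist Q j hj x) as A.
  pose proof (fixed_lmul_twist (swap Q) j (fixed_involution_swap Q j hj) (L x))
    as B.
  pose proof (fixed_lmul_twist Q j hj (L x)) as D.
  cbn in B. rewrite LL in B. rewrite TL in D.
  rewrite A. rewrite <- LT in D. rewrite B in D.
  apply (f_equal (@T Q)) in D. rewrite LT, !TL, TT in D.
  exact D.
Qed.

Lemma fixed_conjC (Q : twisted_loop) (j : Q) (hj : fixed_involution Q j)
    (x : Q) :
  (j ** x) ** j = j ** (x ** j).
Proof.
  rewrite (fixed_lmul_split Q j hj x). apply fixed_rmulK. exact hj.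
Qed.

Lemma fixed_lmulK (Q : twisted_loop) (j : Q) (hj : fixed_involution Q j)
    (x : Q) :
  j ** (j ** x) = x.
Proof.
  apply (op_cancel_r Q j). rewrite (fixed_conjC Q j hj).
  apply fixed_lmul_conj. exact hj.
Qed.

Lemma fixed_lmul_L (Q : twisted_loop) (j : Q) (hj : fixed_involution Q j)
    (x : Q) :
  L (j ** x) = j ** L x.
Proof.
  rewrite (fixed_lmul_twist Q j hj (L x)), TL.
  rewrite <- fixed_lmul_split by exact hj. reflexivity.
Qed.

Lemma fixed_rmul_L (Q : twisted_loop) (j : Q) (hj : fixed_involution Q j)
    (x : Q) :
  L (x ** j) = L x ** j.
Proof.
  rewrite <- (fixed_lmul_conj Q j hj x), fixed_lmul_L, fixed_conj_L by exact hj.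
  apply fixed_lmul_conj. exact hj.
Qed.

Lemma fixed_rmul_T (Q : twisted_loop) (j : Q) (hj : fixed_involution Q j)
    (x : Q) :
  T (x ** j) = T x ** j.
Proof. exact (fixed_rmul_L (swap Q) j (fixed_involution_swap Q j hj) x). Qed.

(** * Elements that R moves by a fixed involution *)

(** The two computations behind this are [T (y ** R y) = T (y ** y) ** j] and
    [R y ** (j ** T y) = L (y ** y)]; the Bol law combines them. *)
Lemma L_mul_R (Q : twisted_loop) (j : Q) (hj : fixed_involution Q j) (y : Q)
    (hy : R y = y ** j) :
  L (y ** R y) = y ** T (R y).
Proof.
  assert (hLRy : L (R y) = L y ** j) by (rewrite hy; apply fixed_rmul_L, hj).
  assert (hsq : T (y ** y) = (L y ** j) ** L y).
  { pose proof (linkL Q y one) as A.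
    rewrite op_one_l, T_one, op_one_r, hLRy in A. symmetry. exact A. }
  assert (hLsq : R y ** (j ** T y) = L (y ** y)).
  { pose proof (linkL Q (L y) j) as A.
    rewrite RL, LT, (fix_T hj), fixed_lmul_L, LL, <- hsq, TT in A by exact hj.
    exact A. }
  assert (hyw : y ** R y = (y ** y) ** j).
  { rewrite <- (LT Q (y ** R y)), <- (LT Q ((y ** y) ** j)). f_equal.
    rewrite (fixed_rmul_T Q j hj), hsq, bol, (fixed_conjC Q j hj).
    pose proof (linkL Q (R y) j) as A.
    rewrite RR, (fix_T hj), fixed_lmul_L, hLRy in A by exact hj.
    rewrite A, hy, fixed_rmulK by exact hj. reflexivity. }
  rewrite hyw, (fixed_rmul_L Q j hj), <- hLsq, hy, bol, (fixed_lmulK Q j hj).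
  rewrite (fixed_rmul_T Q j hj).
  reflexivity.
Qed.

Lemma L_R_mul (Q : twisted_loop) (j : Q) (hj : fixed_involution Q j) (y : Q)
    (hy : R y = y ** j) :
  L (R y ** y) = R y ** T y.
Proof.
  (* The hypothesis passes from [y] to [R y], and [R] exchanges the two. *)
  assert (hRy : R (R y) = R y ** j) by (rewrite RR, hy, fixed_rmulK; trivial).
  pose proof (L_mul_R Q j hj (R y) hRy) as A. rewrite RR in A. exact A.
Qed.

(** With [w = R y], [linkT] at [(T y, 1)] gives [w ** L y = L (T y ** T y)],
    and the mirror image of [L_R_mul] says that the left side is [T (w ** y)].
    So [T y ** T y = L (w ** y) = w ** T y], whence [T y = w]. *)
Lemma fixed_involution_trivial (Q : twisted_loop) (j : Q)
    (hj : fixed_involution Q j) (y : Q) (hy : R y = y ** j) :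
  j = one.
Proof.
  assert (hT : T y = y ** j).
  { rewrite <- hy. apply (op_cancel_r Q (T y)).
    rewrite <- (L_R_mul Q j hj y hy).
    pose proof (L_R_mul (swap Q) j (fixed_involution_swap Q j hj) y hy) as B.
    cbn in B.
    pose proof (linkT Q (T y) one) as A.
    rewrite op_one_l, L_one, op_one_r, RT, TL, TT, <- B in A.
    rewrite <- (TL Q (T y ** T y)), <- A. apply TT. }
  assert (hL : L y = y) by (rewrite <- TT, hT, fixed_rmul_T, hT by exact hj;
                            apply fixed_rmulK, hj).
  apply (op_cancel_l Q y).
  rewrite <- hT, op_one_r, <- LL, !hL. reflexivity.
Qed.

(** * The isotope at an idempotent *)

Definition moufang (G : quasigroup) : Prop :=
  forall x y z : G, ((x * y) * z) * y = x * (y * (z * y)).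

Lemma idem_rmulK (G : quasigroup) (hG : moufang G) (f : G) (hf : f * f = f)
    (x : G) :
  (x * f) * f = x.
Proof. apply (mul_cancel_r G f). rewrite hG, !hf. reflexivity. Qed.

(** [R_f R_z R_f = R_(f(zf))] with the involution [R_f] moved to the other
    side. *)
Lemma idem_rmul_mul (G : quasigroup) (hG : moufang G) (f : G)
    (hf : f * f = f) (x z : G) :
  (x * z) * f = (x * f) * (f * (z * f)).
Proof. rewrite <- hG, idem_rmulK by assumption. reflexivity. Qed.

Lemma idem_rmul_lmul (G : quasigroup) (hG : moufang G) (f : G)
    (hf : f * f = f) (x : G) :
  (f * x) * f = f * (f * (x * f)).
Proof. rewrite idem_rmul_mul, hf by assumption. reflexivity. Qed.

(** Conjugating [R_x] twice by the involution [R_f] gives back [R_x], so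
    [x |-> f (x f)] is an involution; by [idem_rmul_lmul] its square is the
    cube of the left translation by [f]. *)
Lemma idem_lmul3 (G : quasigroup) (hG : moufang G) (f : G) (hf : f * f = f)
    (x : G) :
  f * (f * (f * x)) = x.
Proof.
  apply (mul_cancel_l G f). symmetry.
  rewrite <- (idem_rmulK G hG f hf (f * x)) at 1.
  rewrite (idem_rmul_mul G hG f hf f x), hf.
  rewrite (idem_rmul_mul G hG f hf f (f * (x * f))), hf.
  rewrite (idem_rmul_lmul G hG f hf (x * f)), idem_rmulK by assumption.
  reflexivity.
Qed.

Lemma idem_rmul_lmul2 (G : quasigroup) (hG : moufang G) (f : G)
    (hf : f * f = f) (x : G) :
  (f * (f * x)) * f = f * (x * f).
Proof.
  rewrite !(idem_rmul_lmul G hG f hf), (idem_lmul3 G hG f hf). reflexivity.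
Qed.

Lemma isotope_rmul (G : quasigroup) (hG : moufang G) (f : G)
    (hf : f * f = f) (x z : G) :
  ((x * f) * (f * (f * z))) * f = x * (f * (f * (z * f))).
Proof.
  rewrite idem_rmul_mul, idem_rmulK, idem_rmul_lmul2 by assumption.
  reflexivity.
Qed.

(** In terms of the isotope [x ** z = (x f) * (f (f z))], the identity expresses [((x ** a) ** c) ** a]
    through [x] and an element free of [x]; taking [x = f] identifies that
    element as [(a ** c) ** a]. *)
Lemma isotope_shift (G : quasigroup) (hG : moufang G) (f : G)
    (hf : f * f = f) (x a c : G) :
  (((((x * f) * (f * (f * a))) * f) * (f * (f * c))) * f) * (f * (f * a)) =
  (x * f) * ((f * (f * a)) * ((f * (f * (c * f))) * (f * (f * a)))).
Proof.
  rewrite isotope_rmul by assumption.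
  apply hG.
Qed.

Definition isotope (G : quasigroup) (hG : moufang G) (f : G)
    (hf : f * f = f) : twisted_loop.
Proof.
  pose proof (idem_rmulK G hG f hf) as K.
  pose proof (idem_lmul3 G hG f hf) as L3.
  pose proof (isotope_shift G hG f hf) as S.
  assert (S1 : forall a c : G,
    (((a * f) * (f * (f * c))) * f) * (f * (f * a)) =
    f * ((f * (f * a)) * ((f * (f * (c * f))) * (f * (f * a))))).
  { intros a c. pose proof (S f a c) as B.
    rewrite hf, L3 in B. exact B. }
  assert (EL : forall a b : G,
    ((f * (a * f)) * f) * (f * (f * (f * ((b * f) * (f * (f * a)))))) =
    f * (f * ((((a * f) * (f * (f * (f * (f * b))))) * f) * (f * (f * a))))).
  { intros a b.
    rewrite S1, (idem_rmul_lmul2 G hG f hf b), !L3.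
    rewrite (idem_rmul_lmul G hG f hf (a * f)), K. reflexivity. }
  refine (TwistedLoop G (fun x z => (x * f) * (f * (f * z))) f
    (fun x => x * f) (fun x => f * x) (fun x => f * (f * x))
    _ _ _ _ _ K L3 L3 (fun x => eq_refl) _ _ _ hf _ EL _); cbv beta.
  - intro x. rewrite hf. apply L3.
  - intro x. rewrite !hf. apply K.
  - intros a x z E. do 3 apply mul_cancel_l in E. exact E.
  - intros a x z E. do 2 apply mul_cancel_r in E. exact E.
  - intros x a c. rewrite S, S1, L3. reflexivity.
  - intro x. rewrite L3. reflexivity.
  - apply (idem_rmul_lmul G hG f hf).
  - apply (idem_rmul_lmul2 G hG f hf).
  - rewrite !hf. reflexivity.
  - (* [linkT] is the image of [linkL] at [(R a, R b)] under [R], which is an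
       automorphism of [**] and exchanges [L] with [T]. *)
    intros a b. apply (mul_cancel_r G f).
    assert (EL' : ((f * a) * f) * (b * (f * (f * (a * f)))) =
                  f * (f * (((a * f) * b) * (f * (f * (a * f)))))).
    { pose proof (EL (a * f) (b * f)) as E. rewrite !K, !L3 in E.
      rewrite (idem_rmul_mul G hG f hf a) in E.
      rewrite (idem_rmul_lmul G hG f hf (b * f)), K, L3 in E. exact E. }
    rewrite (idem_rmul_lmul2 G hG f hf (a * f)), K, !L3.
    rewrite (idem_rmul_mul G hG f hf (f * a)).
    rewrite (idem_rmul_lmul G hG f hf ((b * f) * _)), L3.
    rewrite (idem_rmul_mul G hG f hf (b * f)), K.
    rewrite (idem_rmul_lmul2 G hG f hf a), EL'.
    rewrite (idem_rmul_lmul G hG f hf), (idem_rmul_mul G hG f hf (_ * f)).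
    rewrite K, (idem_rmul_lmul2 G hG f hf a). reflexivity.
Defined.

(** * Local right units *)

Lemma mul_j (G : quasigroup) (x : G) : x * j x = x.
Proof. apply mul_ldiv. Qed.

Lemma j_unique (G : quasigroup) (x z : G) : x * z = x -> z = j x.
Proof. intro E. apply (mul_cancel_l G x). rewrite mul_j. exact E. Qed.

(** With [z y = j y], the identity says that [R_y R_z R_y = R_y], so [R_z] is
    inverse to [R_y]. *)
Lemma rmul_inverse (G : quasigroup) (hG : moufang G) (y z : G)
    (hz : z * y = j y) (x : G) :
  (x * y) * z = x.
Proof. apply (mul_cancel_r G y). rewrite hG, hz, mul_j. reflexivity. Qed.

Lemma rmul_jK (G : quasigroup) (hG : moufang G) (y x : G) :
  (x * j y) * j y = x.
Proof.
  destruct (mul_right_solvable (j y) (j (j y))) as [z [hz _]].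
  (* Both [j y] and its inverse [z] fix [y] on the right, so they agree. *)
  assert (E : z = j y).
  { apply j_unique.
    pose proof (rmul_inverse G hG (j y) z hz y) as B.
    rewrite mul_j in B. exact B. }
  rewrite <- E at 2. apply rmul_inverse; assumption.
Qed.

Lemma mul_j_sq (G : quasigroup) (hG : moufang G) (y : G) :
  j y * (j y * j y) = j y.
Proof.
  apply (mul_cancel_l G y). rewrite <- hG, !mul_j. reflexivity.
Qed.

Lemma rmul_sqK (G : quasigroup) (hG : moufang G) (y x : G) :
  (x * (j y * j y)) * (j y * j y) = x.
Proof.
  rewrite (j_unique G (j y) (j y * j y)) by (apply mul_j_sq, hG).
  apply rmul_jK, hG.
Qed.

(** The identity at [(x, f, j)] with [f = j j] reads [R_f R_j R_f = R_j]. *)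
Lemma rmul_conj_sq (G : quasigroup) (hG : moufang G) (y x : G) :
  ((x * (j y * j y)) * j y) * (j y * j y) = x * j y.
Proof. rewrite hG, mul_j_sq, rmul_jK by exact hG. reflexivity. Qed.

Lemma sq_idem (G : quasigroup) (hG : moufang G) (y : G) :
  (j y * j y) * (j y * j y) = j y * j y.
Proof.
  apply (mul_cancel_r G (j y)), (mul_cancel_r G (j y * j y)).
  rewrite rmul_conj_sq, rmul_jK, mul_j_sq by exact hG. reflexivity.
Qed.

(** Since [f] is the unit of the isotope, [fixed_involution_trivial] says
    [j y = f].  The condition [R y = y ** j y] unfolds to [y f = (y f) (j y)],
    which follows from [rmul_conj_sq] at [y]. *)
Lemma j_sq_eq_j (G : quasigroup) (hG : moufang G) (y : G) :
  j y * j y = j y.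
Proof.
  set (f := j y * j y).
  pose (Q := isotope G hG f (sq_idem G hG y)).
  assert (hfj : f * j y = j y) by (apply rmul_jK, hG).
  assert (hjf : j y * f = j y) by (apply mul_j_sq, hG).
  symmetry. apply (fixed_involution_trivial Q (j y)) with (y := y).
  - constructor; cbn; rewrite ?hfj, ?hjf; reflexivity.
  - cbn. rewrite !hfj.
    apply (mul_cancel_r G f). unfold f.
    rewrite (rmul_sqK G hG), (rmul_conj_sq G hG), mul_j. reflexivity.
Qed.

Theorem proposition4p2 (G : quasigroup)
    (hG : forall x y z : G, ((x * y) * z) * y = x * (y * (z * y))) :
  compose (@j G) (@j G) = @j G.
Proof.
  apply functional_extensionality. intro x. unfold compose.
  symmetry. apply j_unique, j_sq_eq_j. exact hG.
Qed.
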